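(* Let $n\ge 1$ and $p\in\mathbb R^n$. Let $\mathcal C_p$ be the congruence on $\mathbb T[x^{\pm}]_{\mathrm{fcn}}$ consisting of all pairs $(f,g)$ such that there exists an open neighborhood $U$ of $p$ (Euclidean topology) with $f|_U=g|_U$. (1) Any congruence $\mathcal C$ on $\mathbb T[x^{\pm}]_{\mathrm{fcn}}$ with $\mathcal C\supset\mathcal C_p$ satisfies exactly one of the following conditions: (a) if $(f,g)\in\mathcal C$, then $f(p)=g(p)$; (b) $(f,g)\in\mathcal C$ for any $f,g\in\mathbb T[x^{\pm}]_{\mathrm{fcn}}\smallsetminus\{-\infty\}$. (2) If $\mathcal C$ is a congruence on $\mathbb T[x^{\pm}]_{\mathrm{fcn}}$ with $\mathcal C\supset\mathcal C_p$ and satisfying condition (a), then there exists a congruence $\mathcal C'$ on $\mathbb B[x^{\pm}]_{\mathrm{fcn}}$ such that $\mathbb T[x^{\pm}]_{\mathrm{fcn}}/\mathcal C$ is isomorphic (as a semiring) to the $\mathbb T$-extension $(\mathbb B[x^{\pm}]_{\mathrm{fcn}}/\mathcal C')\times_e\mathbb T$.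
   Context: Semirings have $0$ (absorbing) and $1$, and homomorphisms preserve both. A congruence on a semiring $R$ is an equivalence relation $\mathcal C\subset R\times R$ compatible with addition and multiplication; $R/\mathcal C$ is the quotient semiring. $\mathbb T=\mathbb R\cup\{-\infty\}$ is the tropical semifield with $a\oplus b=\max\{a,b\}$, $a\odot b=a+b$ (zero element $-\infty$, unit $0$). $\mathbb B=\{-\infty,0\}\subset\mathbb T$ is the Boolean subsemifield. For $S=\mathbb T$ or $\mathbb B$, $S[x^{\pm}]=S[x_1^{\pm},\dots,x_n^{\pm}]$ is the semiring of Laurent polynomials $P=\bigoplus_{u\in\mathbb Z^n}a_u\odot x^u$ with $a_u\in S$ and $a_u=-\infty$ for all but finitely many $u$. Its value at $q\in\mathbb R^n$ is $P(q)=\max_u\{a_u+u\cdot q\}$. $S[x^{\pm}]_{\mathrm{fcn}}$ is the quotient of $S[x^{\pm}]$ by the congruence $\{(P,Q): P(q)=Q(q)\ \forall q\in\mathbb R^n\}$; its elements are regarded as functions on $\mathbb R^n$, and $-\infty$ denotes its zero element (the constant function $-\infty$). $\mathbb T$-extension: let $R$ be a semiring with $R\neq\{0\}$ such that $f+g\ne0$ and $f\cdot g\neq 0$ for all $f,g\in R\smallsetminus\{0\}$. Then $R\times_e\mathbb T$ is the semiring with underlying set $((R\smallsetminus\{0\})\times\mathbb R)\cup\{-\infty\}$, where $(f,a)+(g,b)$ equals $(f,a)$ if $a>b$, $(g,b)$ if $a<b$, and $(f+g,a)$ if $a=b$; $(f,a)\cdot(g,b)=(f\cdot g,a+b)$;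 $-\infty$ is neutral for addition and absorbing for multiplication. (Saying that something is isomorphic to $R\times_e\mathbb T$ includes that $R$ satisfies these assumptions.) *)

(* Defs.v *)
From HB Require Import structures.
From mathcomp Require Import all_boot all_order all_algebra.
From mathcomp Require Import generic_quotient finmap.
From mathcomp Require Import all_classical all_reals all_analysis.
From mathcomp Require Import lra.

Set Implicit Arguments.
Unset Strict Implicit.
Unset Printing Implicit Defensive.

Import Order.TTheory GRing.Theory Num.Theory numFieldNormedType.Exports.

Local Open Scope ring_scope.
Local Open Scope quotient_scope.

Record congruence (S : pzSemiRingType) := Congruence {
  cong_rel :> S -> S -> Prop;
  cong_refl : forall x, cong_rel x x;
  cong_sym : forall x y, cong_rel x y -> cong_rel y x;
  cong_trans : forall x y z, cong_rel x y -> cong_rel y z -> cong_rel x z;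
  cong_add : forall x x' y y',
    cong_rel x x' -> cong_rel y y' -> cong_rel (x + y) (x' + y');
  cong_mul : forall x x' y y',
    cong_rel x x' -> cong_rel y y' -> cong_rel (x * y) (x' * y') }.

Section Quotient.
Variables (S : pzSemiRingType) (C : congruence S).

Definition cong_relb : rel S := fun x y => `[< C x y >].

Lemma cong_relb_equiv : equiv_class_of cong_relb.
Proof.
split=> [x|x y|y x z].
- exact/asboolP/cong_refl.
- by apply: asbool_equiv_eq; split; apply: cong_sym.
- by move=> /asboolP xy /asboolP yz; apply/asboolP; apply: cong_trans xy yz.
Qed.

Canonical cong_relb_equiv_rel := EquivRelPack cong_relb_equiv.

Definition squot : Type := {eq_quot cong_relb}.
HB.instance Definition _ := Choice.on squot.
HB.instance Definition _ := EqQuotient.on squot.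

Definition squot_pi (x : S) : squot := \pi_squot x.

Lemma squot_piP x y : squot_pi x = squot_pi y <-> C x y.
Proof.
split=> [/eqP|xy]; first by rewrite /squot_pi eqquotE => /asboolP.
by apply/eqP; rewrite /squot_pi eqquotE; apply/asboolP.
Qed.

Lemma squot_piK (x : squot) : squot_pi (repr x) = x.
Proof. exact: reprK. Qed.

Lemma squot_reprP x : C (repr (squot_pi x)) x.
Proof. by apply/squot_piP; rewrite squot_piK. Qed.

Definition squot_add (x y : squot) : squot := squot_pi (repr x + repr y).
Definition squot_mul (x y : squot) : squot := squot_pi (repr x * repr y).

Lemma squot_addE x y :
  squot_add (squot_pi x) (squot_pi y) = squot_pi (x + y).
Proof. by apply/squot_piP; apply: cong_add; apply: squot_reprP. Qed.

Lemma squot_mulE x y :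
  squot_mul (squot_pi x) (squot_pi y) = squot_pi (x * y).
Proof. by apply/squot_piP; apply: cong_mul; apply: squot_reprP. Qed.

Lemma squot_ind (P : squot -> Prop) : (forall x, P (squot_pi x)) -> forall x, P x.
Proof. by move=> h x; rewrite -(squot_piK x). Qed.

Let addA : associative squot_add.
Proof.
by elim/squot_ind=> x; elim/squot_ind=> y; elim/squot_ind=> z;
  rewrite !squot_addE addrA.
Qed.
Let addC : commutative squot_add.
Proof. by elim/squot_ind=> x; elim/squot_ind=> y; rewrite !squot_addE addrC. Qed.
Let add0 : left_id (squot_pi 0) squot_add.
Proof. by elim/squot_ind=> x; rewrite squot_addE add0r. Qed.
Let mulA : associative squot_mul.
Proof.
by elim/squot_ind=> x; elim/squot_ind=> y; elim/squot_ind=> z;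
  rewrite !squot_mulE mulrA.
Qed.
Let mul1 : left_id (squot_pi 1) squot_mul.
Proof. by elim/squot_ind=> x; rewrite squot_mulE mul1r. Qed.
Let mulx1 : right_id (squot_pi 1) squot_mul.
Proof. by elim/squot_ind=> x; rewrite squot_mulE mulr1. Qed.
Let mulDl : left_distributive squot_mul squot_add.
Proof.
by elim/squot_ind=> x; elim/squot_ind=> y; elim/squot_ind=> z;
  rewrite !(squot_addE, squot_mulE) mulrDl.
Qed.
Let mulDr : right_distributive squot_mul squot_add.
Proof.
by elim/squot_ind=> x; elim/squot_ind=> y; elim/squot_ind=> z;
  rewrite !(squot_addE, squot_mulE) mulrDr.
Qed.
Let mul0x : left_zero (squot_pi 0) squot_mul.
Proof. by elim/squot_ind=> x; rewrite squot_mulE mul0r. Qed.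
Let mulx0 : right_zero (squot_pi 0) squot_mul.
Proof. by elim/squot_ind=> x; rewrite squot_mulE mulr0. Qed.

HB.instance Definition _ := GRing.isPzSemiRing.Build squot
  addA addC add0 mulA mul1 mulx1 mulDl mulDr mul0x mulx0.

Lemma squot_pi_nmod_morphism : nmod_morphism squot_pi.
Proof. by split=> // x y; rewrite -squot_addE. Qed.
Lemma squot_pi_monoid_morphism : monoid_morphism squot_pi.
Proof. by split=> // x y; rewrite -squot_mulE. Qed.

HB.instance Definition _ :=
  GRing.isNmodMorphism.Build S squot squot_pi squot_pi_nmod_morphism.
HB.instance Definition _ :=
  GRing.isMonoidMorphism.Build S squot squot_pi squot_pi_monoid_morphism.

End Quotient.

Definition semiring_iso (S S' : pzSemiRingType) : Prop :=
  exists phi : {rmorphism S -> S'}, bijective phi.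

(* [None] is -oo; in the semiring structure below, [0] is -oo and [1] is the
   real number 0. *)
Definition trop (R : realType) : Type := option R.

Section Trop.
Variable R : realType.
HB.instance Definition _ := Choice.on (trop R).

Definition trop_add (a b : trop R) : trop R :=
  match a, b with
  | None, _ => b
  | _, None => a
  | Some x, Some y => Some (Num.max x y)
  end.

Definition trop_mul (a b : trop R) : trop R :=
  match a, b with
  | Some x, Some y => Some (x + y)
  | _, _ => None
  end.

Let addA : associative trop_add.
Proof. by move=> [x|] [y|] [z|] //=; rewrite maxA. Qed.
Let addC : commutative trop_add.
Proof. by move=> [x|] [y|] //=; rewrite maxC. Qed.
Let add0 : left_id None trop_add. Proof. by case. Qed.

HB.instance Definition _ := GRing.isNmodule.Build (trop R) addA addC add0.

Let mulA : associative trop_mul.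
Proof. by move=> [x|] [y|] [z|] //=; rewrite addrA. Qed.
Let mulC : commutative trop_mul.
Proof. by move=> [x|] [y|] //=; rewrite addrC. Qed.
Let mul1 : left_id (Some 0) trop_mul.
Proof. by move=> [x|] //=; rewrite add0r. Qed.
Let mulDl : left_distributive trop_mul trop_add.
Proof. by move=> [x|] [y|] [z|] //=; rewrite addr_maxl. Qed.
Let mul0 : left_zero None trop_mul. Proof. by []. Qed.

HB.instance Definition _ := GRing.Nmodule_isComPzSemiRing.Build (trop R)
  mulA mulC mul1 mulDl mul0.

Definition boolean_pred : pred (trop R) := fun a => (a == 0) || (a == 1).

Let boolean_semiring_closed : semiring_closed boolean_pred.
Proof.
have add11 : 1 + 1 = 1 :> trop R by congr Some; apply: maxxx.
split; split; rewrite ?unfold_in /boolean_pred ?eqxx ?orbT // => x y;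
  rewrite !unfold_in => /orP[]/eqP-> /orP[]/eqP->;
  by rewrite ?(add11, add0r, addr0, mul0r, mul1r) eqxx ?orbT.
Qed.

Record boolean := Boolean { boolean_val : trop R; _ : boolean_pred boolean_val }.

HB.instance Definition _ := [isSub for boolean_val].
HB.instance Definition _ := [Choice of boolean by <:].
HB.instance Definition _ := GRing.SubChoice_isSubComPzSemiRing.Build
  (trop R) boolean_pred boolean boolean_semiring_closed.

End Trop.

(* The coefficient of x^u in [P : laurent S n] is [P u]. *)
Definition laurent (S : pzSemiRingType) (n : nat) : Type :=
  {fsfun 'rV[int]_n -> S with 0}.

Section Laurent.
Variables (S : pzSemiRingType) (n : nat).
Local Notation V := 'rV[int]_n.
Local Notation L := (laurent S n).

HB.instance Definition _ := Choice.on L.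

Definition laurent_zero : L := [fsfun].

Definition laurent_one : L := [fsfun u in [fset (0 : V)%R]%fset => 1 : S].

Definition laurent_add (P Q : L) : L :=
  [fsfun u in (finsupp P `|` finsupp Q)%fset => P u + Q u].

Definition laurent_mul (P Q : L) : L :=
  [fsfun w in [fset (u + v)%R | u in finsupp P, v in finsupp Q]%fset =>
    \sum_(u <- finsupp P) \sum_(v <- finsupp Q | u + v == w) P u * Q v].

Lemma laurent_zeroE u : laurent_zero u = 0.
Proof. by rewrite fsfunE. Qed.

Lemma laurent_oneE u : laurent_one u = if u == 0 then 1 else 0.
Proof. by rewrite fsfunE inE. Qed.

Lemma laurent_addE (P Q : L) u : laurent_add P Q u = P u + Q u.
Proof.
rewrite fsfunE inE; case: (finsuppP P); case: (finsuppP Q) => * /=;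
  by rewrite ?addr0.
Qed.

Lemma laurent_mulE (P Q : L) w : laurent_mul P Q w =
  \sum_(u <- finsupp P) \sum_(v <- finsupp Q | u + v == w) P u * Q v.
Proof.
rewrite fsfunE; case: ifPn => // wN.
rewrite big_seq big1 // => u uP; rewrite big_seq_cond big1 // => v /andP[vQ uvw].
by case/negP: wN; apply/imfset2P; exists u => //; exists v => //; rewrite (eqP uvw).
Qed.

Section Sum.
Variables (W : nmodType) (F : V -> S -> W).
Hypothesis F0 : forall u, F u 0 = 0.
Hypothesis FD : forall u a b, F u (a + b) = F u a + F u b.

Lemma laurent_sum_incl (A : {fset V}) (P : L) : (finsupp P `<=` A)%fset ->
  \sum_(u <- finsupp P) F u (P u) = \sum_(u <- A) F u (P u).
Proof.
by move=> PA; apply: big_fset_incl => // u _ uP; rewrite fsfun_dflt.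
Qed.

Lemma laurent_sum0 : \sum_(u <- finsupp laurent_zero) F u (laurent_zero u) = 0.
Proof. by rewrite big1 // => u _; rewrite laurent_zeroE. Qed.

Lemma laurent_sum1 :
  \sum_(u <- finsupp laurent_one) F u (laurent_one u) = F 0 1.
Proof.
rewrite (@laurent_sum_incl [fset 0%R]%fset); last first.
  by apply/fsubsetP=> u; rewrite mem_finsupp laurent_oneE inE; case: (u == 0) => //; rewrite eqxx.
by rewrite big_seq_fset1 laurent_oneE eqxx.
Qed.

Lemma laurent_sumD (P Q : L) :
  \sum_(u <- finsupp (laurent_add P Q)) F u (laurent_add P Q u) =
  \sum_(u <- finsupp P) F u (P u) + \sum_(u <- finsupp Q) F u (Q u).
Proof.
have sub : (finsupp (laurent_add P Q) `<=` finsupp P `|` finsupp Q)%fset.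
  apply/fsubsetP=> u; rewrite inE !mem_finsupp laurent_addE.
  by case: (P u =P 0) => [->|//]; rewrite add0r.
rewrite (laurent_sum_incl sub) (@laurent_sum_incl _ P (fsubsetUl _ (finsupp Q))).
rewrite (@laurent_sum_incl _ Q (fsubsetUr (finsupp P) _)) -big_split /=.
by apply: eq_bigr => u _; rewrite laurent_addE FD.
Qed.

Lemma laurent_sumM (P Q : L) :
  \sum_(w <- finsupp (laurent_mul P Q)) F w (laurent_mul P Q w) =
  \sum_(u <- finsupp P) \sum_(v <- finsupp Q) F (u + v) (P u * Q v).
Proof.
have Fsum w (r : seq V) (p : pred V) (E : V -> S) :
    F w (\sum_(i <- r | p i) E i) = \sum_(i <- r | p i) F w (E i).
  exact: (big_morph (F w) (FD w) (F0 w)).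
pose A := [fset (u + v)%R | u in finsupp P, v in finsupp Q]%fset.
have sub : (finsupp (laurent_mul P Q) `<=` A)%fset.
  by apply/fsubsetP=> w; rewrite mem_finsupp fsfunE; case: ifP => // _; rewrite eqxx.
rewrite (laurent_sum_incl sub).
under eq_bigr => w _ do rewrite laurent_mulE Fsum.
rewrite exchange_big /= big_seq [RHS]big_seq; apply: eq_bigr => u uP.
under eq_bigr => w _ do rewrite Fsum big_mkcond.
rewrite exchange_big /= big_seq [RHS]big_seq; apply: eq_bigr => v vQ.
have uvA : u + v \in A by apply/imfset2P; exists u => //; exists v.
rewrite (big_fsetD1 (u + v)) //= eqxx big_seq big1 ?addr0 // => w.
by rewrite !inE eq_sym => /andP[/negPf-> _].
Qed.

End Sum.

Let addA : associative laurent_add.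
Proof. by move=> P Q T; apply/fsfunP=> u; rewrite !laurent_addE addrA. Qed.
Let addC : commutative laurent_add.
Proof. by move=> P Q; apply/fsfunP=> u; rewrite !laurent_addE addrC. Qed.
Let add0 : left_id laurent_zero laurent_add.
Proof.
by move=> P; apply/fsfunP=> u; rewrite laurent_addE laurent_zeroE add0r.
Qed.

Lemma laurent_coefE (P : L) w :
  P w = \sum_(u <- finsupp P) (if u == w then P u else 0).
Proof.
case: (finsuppP P w) => [wP|wP].
  rewrite big_seq big1 // => u uP; case: eqP => // uw.
  by move: wP; rewrite -uw uP.
rewrite (big_fsetD1 w) //= eqxx big_seq big1 ?addr0 // => u.
by rewrite !inE => /andP[/negPf-> _].
Qed.

Lemma laurent_mulE2 (P Q : L) w : laurent_mul P Q w =
  \sum_(u <- finsupp P) \sum_(v <- finsupp Q) if u + v == w then P u * Q v else 0.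
Proof. by rewrite laurent_mulE; apply: eq_bigr => u _; rewrite big_mkcond. Qed.

Let l_term (Q : L) (w u : V) (a : S) : S :=
  \sum_(v <- finsupp Q) if u + v == w then a * Q v else 0.
Let l_term0 Q w u : l_term Q w u 0 = 0.
Proof. by apply: big1 => v _; rewrite mul0r if_same. Qed.
Let l_termD Q w u a b : l_term Q w u (a + b) = l_term Q w u a + l_term Q w u b.
Proof.
rewrite /l_term -big_split /=; apply: eq_bigr => v _.
by case: eqP => _; rewrite ?addr0 // mulrDl.
Qed.
Let r_term (c : S) (u w v : V) (a : S) : S := if u + v == w then c * a else 0.
Let r_term0 c u w v : r_term c u w v 0 = 0.
Proof. by rewrite /r_term mulr0 if_same. Qed.
Let r_termD c u w v a b : r_term c u w v (a + b) = r_term c u w v a + r_term c u w v b.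
Proof. by rewrite /r_term mulrDr; case: eqP => _; rewrite ?addr0. Qed.

Let mulA : associative laurent_mul.
Proof.
move=> P Q T; apply/fsfunP=> w; rewrite laurent_mulE2.
under eq_bigr => u _ do
  rewrite (laurent_sumM (r_term0 (P u) u w) (r_termD (P u) u w)).
rewrite laurent_mulE2 (laurent_sumM (l_term0 T w) (l_termD T w)).
apply: eq_bigr => u _; apply: eq_bigr => v _; apply: eq_bigr => z _.
by rewrite /r_term addrA mulrA.
Qed.

Let mul1 : left_id laurent_one laurent_mul.
Proof.
move=> P; apply/fsfunP=> w.
rewrite laurent_mulE2 (laurent_sum1 (l_term0 P w)) [RHS]laurent_coefE.
by apply: eq_bigr => u _; rewrite add0r mul1r.
Qed.

Let mulx1 : right_id laurent_one laurent_mul.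
Proof.
move=> P; apply/fsfunP=> w; rewrite laurent_mulE2 [RHS]laurent_coefE.
apply: eq_bigr => u _; rewrite (laurent_sum1 (r_term0 (P u) u w)).
by rewrite /r_term addr0 mulr1.
Qed.

Let mulDl : left_distributive laurent_mul laurent_add.
Proof.
move=> P Q T; apply/fsfunP=> w; rewrite laurent_addE !laurent_mulE2.
exact: (laurent_sumD (l_term0 T w) (l_termD T w)).
Qed.

Let mulDr : right_distributive laurent_mul laurent_add.
Proof.
move=> P Q T; apply/fsfunP=> w; rewrite laurent_addE !laurent_mulE2 -big_split /=.
by apply: eq_bigr => u _; exact: (laurent_sumD (r_term0 (P u) u w) (r_termD (P u) u w)).
Qed.

Let mul0x : left_zero laurent_zero laurent_mul.
Proof.
by move=> P; apply/fsfunP=> w; rewrite laurent_mulE2 laurent_zeroE (laurent_sum0 (l_term0 P w)).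
Qed.

Let mulx0 : right_zero laurent_zero laurent_mul.
Proof.
move=> P; apply/fsfunP=> w; rewrite laurent_mulE2 laurent_zeroE big1 // => u _.
exact: (laurent_sum0 (r_term0 (P u) u w)).
Qed.

HB.instance Definition _ := GRing.isPzSemiRing.Build L
  addA addC add0 mulA mul1 mulx1 mulDl mulDr mul0x mulx0.

End Laurent.

Section Eval.
Variables (R : realType) (S : pzSemiRingType) (iota : {rmorphism S -> trop R}).
Variable n : nat.

Definition dotz (u : 'rV[int]_n) (q : 'rV[R]_n) : R :=
  \sum_(i < n) (u 0 i)%:~R * q 0 i.

(* sum and product are those of T, so that this is max_u (a_u + u . q) *)
Definition laurent_eval (P : laurent S n) (q : 'rV[R]_n) : trop R :=
  \sum_(u <- finsupp P) iota (P u) * (Some (dotz u q) : trop R).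

Let term q (u : 'rV[int]_n) (a : S) : trop R :=
  iota a * (Some (dotz u q) : trop R).
Let term0 q u : term q u 0 = 0. Proof. by rewrite /term rmorph0 mul0r. Qed.
Let termD q u a b : term q u (a + b) = term q u a + term q u b.
Proof. by rewrite /term rmorphD mulrDl. Qed.

Lemma dotz0 q : dotz 0 q = 0.
Proof. by rewrite /dotz big1 // => i _; rewrite mxE mul0r. Qed.

Lemma dotzD u v q : dotz (u + v) q = dotz u q + dotz v q.
Proof.
by rewrite /dotz -big_split /=; apply: eq_bigr => i _; rewrite mxE intrD mulrDl.
Qed.

Lemma laurent_eval0 q : laurent_eval 0 q = 0.
Proof. exact: (laurent_sum0 (term0 q)). Qed.

Lemma laurent_eval1 q : laurent_eval 1 q = 1.
Proof.
by rewrite /laurent_eval (laurent_sum1 (term0 q)) /term rmorph1 mul1r dotz0.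
Qed.

Lemma laurent_evalD P Q q :
  laurent_eval (P + Q) q = laurent_eval P q + laurent_eval Q q.
Proof. exact: (laurent_sumD (term0 q) (termD q)). Qed.

Lemma laurent_evalM P Q q :
  laurent_eval (P * Q) q = laurent_eval P q * laurent_eval Q q.
Proof.
rewrite /laurent_eval (laurent_sumM (term0 q) (termD q)) mulr_suml.
apply: eq_bigr => u _; rewrite mulr_sumr; apply: eq_bigr => v _.
by rewrite /term rmorphM mulrACA; congr (_ * _); rewrite dotzD.
Qed.

Definition fcn_cong : congruence (laurent S n).
Proof.
refine (@Congruence _ (fun P Q => forall q, laurent_eval P q = laurent_eval Q q)
  _ _ _ _ _).
- by [].
- by move=> P Q PQ q; rewrite PQ.
- by move=> P Q T PQ QT q; rewrite PQ.
- by move=> P P' Q Q' PP' QQ' q; rewrite !laurent_evalD PP' QQ'.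
- by move=> P P' Q Q' PP' QQ' q; rewrite !laurent_evalM PP' QQ'.
Defined.

Definition fcn : pzSemiRingType := squot fcn_cong.

Definition fcn_eval (f : fcn) (q : 'rV[R]_n) : trop R :=
  laurent_eval (repr (f : squot fcn_cong)) q.

Lemma fcn_evalE (P : laurent S n) q :
  fcn_eval (squot_pi fcn_cong P) q = laurent_eval P q.
Proof. exact: (squot_reprP fcn_cong). Qed.

Lemma fcn_evalP (f g : fcn) : (forall q, fcn_eval f q = fcn_eval g q) <-> f = g.
Proof.
split=> [|-> //]; elim/(@squot_ind _ fcn_cong): f => P.
elim/(@squot_ind _ fcn_cong): g => Q fg; apply/squot_piP => q.
by rewrite -!fcn_evalE.
Qed.

Lemma fcn_evalD f g q : fcn_eval (f + g) q = fcn_eval f q + fcn_eval g q.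
Proof.
elim/(@squot_ind _ fcn_cong): f => P; elim/(@squot_ind _ fcn_cong): g => Q.
by rewrite -rmorphD !fcn_evalE laurent_evalD.
Qed.

Lemma fcn_evalM f g q : fcn_eval (f * g) q = fcn_eval f q * fcn_eval g q.
Proof.
elim/(@squot_ind _ fcn_cong): f => P; elim/(@squot_ind _ fcn_cong): g => Q.
by rewrite -rmorphM !fcn_evalE laurent_evalM.
Qed.

End Eval.

Definition tropfcn (R : realType) (n : nat) : pzSemiRingType :=
  fcn (@idfun (trop R)) n.

Definition boolfcn (R : realType) (n : nat) : pzSemiRingType :=
  fcn (val : boolean R -> trop R) n.

Record extendable (S : pzSemiRingType) : Prop := Extendable {
  ext_nontrivial : exists f : S, f != 0;
  ext_add : forall f g : S, f != 0 -> g != 0 -> f + g != 0;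
  ext_mul : forall f g : S, f != 0 -> g != 0 -> f * g != 0 }.

(* [None] is -oo. [h] makes the semiring structure below well defined. *)
Definition textension (S : pzSemiRingType) (h : extendable S) (R : realType) : Type :=
  option ({f : S | f != 0} * R).

Section TExtension.
Variables (S : pzSemiRingType) (h : extendable S) (R : realType).
Local Notation S0 := {f : S | f != 0}.
Local Notation X := (textension h R).

HB.instance Definition _ := Choice.on X.

Definition nz_add (f g : S0) : S0 :=
  exist _ (val f + val g) (ext_add h (valP f) (valP g)).
Definition nz_mul (f g : S0) : S0 :=
  exist _ (val f * val g) (ext_mul h (valP f) (valP g)).

Lemma ext_one_neq0 : (1 : S) != 0.
Proof.
have [f f0] := ext_nontrivial h; apply: contra_neq f0 => e.
by rewrite -[f]mul1r e mul0r.
Qed.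

Definition nz_one : S0 := exist _ 1 ext_one_neq0.

Definition textension_add (x y : X) : X :=
  match x, y with
  | None, _ => y
  | _, None => x
  | Some (f, a), Some (g, b) =>
      if b < a then x else if a < b then y else Some (nz_add f g, a)
  end.

Definition textension_mul (x y : X) : X :=
  match x, y with
  | Some (f, a), Some (g, b) => Some (nz_mul f g, a + b)
  | _, _ => None
  end.

Let nz_addA : associative nz_add.
Proof. by move=> f g k; apply: val_inj; rewrite /= addrA. Qed.
Let nz_addC : commutative nz_add.
Proof. by move=> f g; apply: val_inj; rewrite /= addrC. Qed.
Let nz_mulA : associative nz_mul.
Proof. by move=> f g k; apply: val_inj; rewrite /= mulrA. Qed.
Let nz_mulDl : left_distributive nz_mul nz_add.
Proof. by move=> f g k; apply: val_inj; rewrite /= mulrDl. Qed.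
Let nz_mulDr : right_distributive nz_mul nz_add.
Proof. by move=> f g k; apply: val_inj; rewrite /= mulrDr. Qed.
Let nz_mul1 : left_id nz_one nz_mul.
Proof. by move=> f; apply: val_inj; rewrite /= mul1r. Qed.
Let nz_mulx1 : right_id nz_one nz_mul.
Proof. by move=> f; apply: val_inj; rewrite /= mulr1. Qed.

Let addA : associative textension_add.
Proof.
move=> [[f a]|] [[g b]|] [[k c]|] //=.
- by case: (ltgtP a b) => ab; case: (ltgtP b c) => bc //=;
    do 3?[case: ltgtP => ? //=]; subst; rewrite ?nz_addA //;
    exfalso; lra.
- by case: ltgtP.
Qed.

Let addC : commutative textension_add.
Proof.
move=> [[f a]|] [[g b]|] //=.
by case: (ltgtP a b) => // e; rewrite ?e nz_addC.
Qed.

Let add0 : left_id None textension_add. Proof. by []. Qed.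

Let mulA : associative textension_mul.
Proof. by move=> [[f a]|] [[g b]|] [[k c]|] //=; rewrite nz_mulA addrA. Qed.

Let mul1 : left_id (Some (nz_one, 0)) textension_mul.
Proof. by move=> [[f a]|] //=; rewrite nz_mul1 add0r. Qed.

Let mulx1 : right_id (Some (nz_one, 0)) textension_mul.
Proof. by move=> [[f a]|] //=; rewrite nz_mulx1 addr0. Qed.

Let mulDl : left_distributive textension_mul textension_add.
Proof.
move=> [[f a]|] [[g b]|] [[k c]|] //=; rewrite ?ltrD2r.
- by case: (ltgtP a b) => //= e; rewrite ?e nz_mulDl.
- by case: ltgtP.
Qed.

Let mulDr : right_distributive textension_mul textension_add.
Proof.
move=> [[f a]|] [[g b]|] [[k c]|] //=; rewrite ?ltrD2l.
by case: (ltgtP b c) => //= e; rewrite ?e nz_mulDr.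
Qed.

Let mul0x : left_zero None textension_mul. Proof. by []. Qed.
Let mulx0 : right_zero None textension_mul. Proof. by case=> [[]|]. Qed.

HB.instance Definition _ := GRing.isPzSemiRing.Build X
  addA addC add0 mulA mul1 mulx1 mulDl mulDr mul0x mulx0.

End TExtension.

Definition germ_cong (R : realType) (n : nat) (p : 'rV[R]_n) :
  congruence (tropfcn R n).
Proof.
refine (@Congruence _ (fun f g => exists U : set 'rV[R]_n,
    [/\ open U, U p & forall q, U q -> fcn_eval f q = fcn_eval g q]) _ _ _ _ _).
- by move=> f; exists setT; split=> //; exact: openT.
- by move=> f g [U [oU Up fg]]; exists U; split=> // q Uq; rewrite fg.
- move=> f g k [U [oU Up fg]] [W [oW Wp gk]]; exists (U `&` W)%classic.
  by split=> [||q [Uq Wq]]; [exact: openI | | rewrite fg // gk].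
- move=> f f' g g' [U [oU Up ff']] [W [oW Wp gg']]; exists (U `&` W)%classic.
  split=> [||q [Uq Wq]]; [exact: openI | by [] |].
  by rewrite !fcn_evalD ff' // gg'.
- move=> f f' g g' [U [oU Up ff']] [W [oW Wp gg']]; exists (U `&` W)%classic.
  split=> [||q [Uq Wq]]; [exact: openI | by [] |].
  by rewrite !fcn_evalM ff' // gg'.
Defined.

(* Main.v *)
Require Import Defs.
From mathcomp Require Import all_boot all_order all_algebra.
From mathcomp Require Import all_classical all_reals all_analysis.
From HB Require Import structures.
From mathcomp Require Import finmap lra.
Import GRing.Theory.
Import Order.TTheory Num.Theory numFieldNormedType.Exports.
Local Open Scope ring_scope.

Set Implicit Arguments.
Unset Strict Implicit.
Unset Printing Implicit Defensive.

(** Near p, a nonzero tropical function f agrees with f(p) plus phi(q - p) for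
    a Boolean function phi (keep the monomials of f that are maximal at p).
    Hence a congruence C containing the germ congruence and separating values
    at p is determined by C' = {(phi, psi) : phi(q - p) C psi(q - p)}, and
    (phi, a) |-> a + phi(q - p) is the isomorphism.  If instead C relates f and
    g with g(p) < f(p), adding a constant c with g(p) < c < f(p) relates f to
    c, so C identifies an interval of constants, then all constants, and
    finally every nonzero function with a large constant. *)

(** * Laurent polynomial functions as finite sums of monomials; continuity *)

Section Fcn.
Variables (R : realType) (S : pzSemiRingType) (iota : {rmorphism S -> trop R}).
Variable n : nat.
Local Notation F := (fcn iota n).

Definition monomial (a : S) (u : 'rV[int]_n) : F :=
  squot_pi _ ([fsfun v in [fset u]%fset => a] : laurent S n).

Lemma monomialE a u q :
  fcn_eval (monomial a u) q = iota a * (Some (dotz u q) : trop R).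
Proof.
rewrite fcn_evalE /laurent_eval.
set P : laurent S n := fsfun_of_fun _ _ _ _.
(* The sum is enlarged to the singleton of [u], because the support of [P] is empty when [a] is
   zero. *)
rewrite (laurent_sum_incl (F := fun u a => iota a * (Some (dotz u q) : trop R))
  _ (A := [fset u]%fset)) /=.
- by rewrite big_seq_fset1 /P fsfunE inE eqxx.
- by move=> v; rewrite rmorph0 mul0r.
- apply/fsubsetP => v; rewrite mem_finsupp /P fsfunE.
  by case: ifP => //; rewrite eqxx.
Qed.

Lemma fcn_eval0 q : fcn_eval (0 : F) q = 0.
Proof. by rewrite (fcn_evalE iota 0) laurent_eval0. Qed.

Lemma fcn_eval1 q : fcn_eval (1 : F) q = 1.
Proof. by rewrite (fcn_evalE iota 1) laurent_eval1. Qed.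

Lemma fcn_neq0 q (f : F) : fcn_eval f q != 0 -> f != 0.
Proof. by apply: contra_neq => ->; exact: fcn_eval0. Qed.

(** Every class is the finite sum of the monomials of a representative. The induction serves below
    to avoid supports altogether. *)
Lemma fcn_ind (Q : F -> Prop) :
  Q 0 -> (forall a u, Q (monomial a u)) ->
  (forall f g, Q f -> Q g -> Q (f + g)) -> forall f, Q f.
Proof.
move=> Q0 Qm QD f; elim/(@squot_ind _ (fcn_cong iota n)): f => P.
suff -> : squot_pi (fcn_cong iota n) P =
    \sum_(u <- finsupp P) monomial (P u) u by exact: big_ind.
apply/(fcn_evalP (iota := iota)) => q; rewrite fcn_evalE /laurent_eval.
rewrite (big_morph (fun f : F => fcn_eval f q) (id1 := 0) (op1 := +%R)).
- by apply: eq_bigr => u _; rewrite monomialE.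
- by move=> f g; rewrite fcn_evalD.
- exact: fcn_eval0.
Qed.

Lemma continuous_dotz (u : 'rV[int]_n) :
  continuous (fun q : 'rV[R]_n => dotz u q).
Proof.
apply: (continuous_big (U := R^o) (op := +%R) (@add_continuous R^o)) => i _.
by move=> q; apply: continuousM; [exact: cst_continuous | exact: coord_continuous].
Qed.

(** A single finite coefficient makes the maximum finite at every point, and a maximum of continuous
    functions is continuous. Strict inequalities at [p] therefore persist nearby. *)
Lemma fcn_finite (f : F) : f = 0 \/ exists g : 'rV[R]_n -> R,
  continuous g /\ forall q, fcn_eval f q = Some (g q).
Proof.
elim/fcn_ind: f => [|a u|f g]; first by left.
- case ia: (iota a) => [c|].
    right; exists (fun q => c + dotz u q); split=> q; last by rewrite monomialE ia.
    by apply: continuousD; [exact: cst_continuous | exact: continuous_dotz].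
  left; apply/(fcn_evalP (iota := iota)) => q.
  by rewrite monomialE fcn_eval0 ia.
- case=> [->|[f' [cf ff]]]; case=> [->|[g' [cg gg]]]; rewrite ?addr0 ?add0r.
  + by left.
  + by right; exists g'.
  + by right; exists f'.
  + right; exists (fun q => Num.max (f' q) (g' q)); split=> q; last first.
      by rewrite fcn_evalD ff gg.
    by apply: continuous_max; [exact: cf | exact: cg].
Qed.

Lemma fcn_eval_neq0 q (f : F) : f != 0 -> fcn_eval f q != 0.
Proof. by have [->|[g [_ ->]]] := fcn_finite f; rewrite ?eqxx. Qed.

End Fcn.

(** * Translation to [p], and germs at [p] as constants plus translated Boolean functions *)

Section Translation.
Variables (R : realType) (n : nat) (p : 'rV[R]_n).
Local Notation T := (tropfcn R n).

Lemma dotzB (u : 'rV[int]_n) (q : 'rV[R]_n) :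
  dotz u (q - p) = dotz u q - dotz u p.
Proof.
by rewrite /dotz -sumrB; apply: eq_bigr => i _; rewrite !mxE mulrBr.
Qed.

Definition cst (c : R) : T := monomial idfun (Some c) 0.

Lemma cstE c q : fcn_eval (cst c) q = Some c.
Proof. by rewrite monomialE dotz0 /GRing.mul /= addr0. Qed.

Lemma cst_neq0 c : cst c != 0.
Proof. by apply: (fcn_neq0 (q := 0)); rewrite cstE. Qed.

Lemma cst0 : cst 0 = 1.
Proof. by apply/(fcn_evalP (iota := idfun)) => q; rewrite [RHS]fcn_eval1 cstE. Qed.

Lemma cstD a b : cst (a + b) = cst a * cst b.
Proof.
by apply/(fcn_evalP (iota := idfun)) => q; rewrite fcn_evalM !cstE.
Qed.

(** [tropfcn] is declared only as a [pzSemiRingType], so commutation is read off from the values in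
    [trop R]. *)
Lemma cst_comm c (f : T) : cst c * f = f * cst c.
Proof.
by apply/(fcn_evalP (iota := idfun)) => q; rewrite !fcn_evalM mulrC.
Qed.

(** Translation by [p] turns the coefficient [a] of x^u into [a] minus u.p. This is why the result
    is tropical even for Boolean [f]. *)
Lemma fcn_translate_ex (S : pzSemiRingType) (iota : {rmorphism S -> trop R})
    (f : fcn iota n) :
  exists g : T, forall q, fcn_eval g q = fcn_eval f (q - p).
Proof.
elim/fcn_ind: f => [|a u|f1 f2 [g1 h1] [g2 h2]].
- by exists 0 => q; rewrite !fcn_eval0.
- exists (monomial idfun (iota a * (Some (- dotz u p) : trop R)) u) => q.
  rewrite !monomialE /= dotzB -mulrA; congr (_ * _).
  by rewrite /GRing.mul /= addrC.
- by exists (g1 + g2) => q; rewrite !fcn_evalD h1 h2.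
Qed.

Definition translate (S : pzSemiRingType) (iota : {rmorphism S -> trop R})
    (f : fcn iota n) : T :=
  sval (cid (fcn_translate_ex f)).

Section TranslateTheory.
Variables (S : pzSemiRingType) (iota : {rmorphism S -> trop R}).
Local Notation F := (fcn iota n).

Lemma translateE (f : F) q : fcn_eval (translate f) q = fcn_eval f (q - p).
Proof. by rewrite /translate; case: cid. Qed.

Lemma translate0 : translate (0 : F) = 0.
Proof.
by apply/(fcn_evalP (iota := idfun)) => q; rewrite translateE !fcn_eval0.
Qed.

Lemma translate1 : translate (1 : F) = 1.
Proof.
by apply/(fcn_evalP (iota := idfun)) => q; rewrite translateE !fcn_eval1.
Qed.

Lemma translateD (f g : F) : translate (f + g) = translate f + translate g.
Proof.
apply/(fcn_evalP (iota := idfun)) => q.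
by rewrite fcn_evalD !translateE fcn_evalD.
Qed.

Lemma translateM (f g : F) : translate (f * g) = translate f * translate g.
Proof.
apply/(fcn_evalP (iota := idfun)) => q.
by rewrite fcn_evalM !translateE fcn_evalM.
Qed.

End TranslateTheory.

Lemma germ_absorb (f g : T) a b : fcn_eval f p = Some a ->
  fcn_eval g p = Some b -> b < a -> germ_cong p (f + g) f.
Proof.
have [->|[f' [cf ff]]] := fcn_finite f; first by rewrite fcn_eval0.
have [->|[g' [cg gg]]] := fcn_finite g; first by rewrite fcn_eval0.
rewrite ff gg => -[<-] [<-] ba.
(* The neighborhood is the open set where [g' < f']; there the maximum is [f']. *)
exists ((fun q => f' q - g' q) @^-1` [set x | 0 < x])%classic; split.
- apply: open_comp; last exact: open_gt.
  by move=> q _; apply: continuousB; [exact: cf | exact: cg].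
- by rewrite /= subr_gt0.
- move=> q /=; rewrite subr_gt0 => gf; rewrite fcn_evalD ff gg.
  by congr Some; apply: max_l; apply: ltW.
Qed.

(** At the origin each monomial takes its coefficient as value, so the value of [f] is Boolean;
    being different from -oo, it is the real number 0. *)
Lemma boolfcn_eval0 (f : boolfcn R n) :
  f != 0 -> fcn_eval f 0 = Some 0.
Proof.
move=> /(fcn_eval_neq0 0).
suff [b ->] : exists b : boolean R, fcn_eval f 0 = val b.
  by case: b => b /= /orP[] /eqP ->; rewrite ?eqxx.
elim/fcn_ind: f => [|a u|f g [b fb] [c gc]].
- by exists 0; rewrite fcn_eval0.
- exists a; rewrite monomialE (_ : dotz u 0 = 0) ?mulr1 //.
  by rewrite /dotz big1 // => i _; rewrite mxE mulr0.
- by exists (b + c); rewrite fcn_evalD fb gc.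
Qed.

Lemma translate_eval (f : boolfcn R n) :
  f != 0 -> fcn_eval (translate f) p = Some 0.
Proof. by move=> f0; rewrite translateE subrr boolfcn_eval0. Qed.

Lemma cst_translate_eval (f : boolfcn R n) a :
  f != 0 -> fcn_eval (cst a * translate f) p = Some a.
Proof.
by move=> f0; rewrite fcn_evalM cstE translate_eval // /GRing.mul /= addr0.
Qed.

(** Induction on sums: the summand with the larger value at [p] absorbs the other, and at equal
    values the Boolean parts add up. *)
Lemma germ_decomp (f : T) : f = 0 \/ exists a (phi : boolfcn R n),
  phi != 0 /\ germ_cong p f (cst a * translate phi).
Proof.
elim/fcn_ind: f => [|[c|] u|f g].
- by left.
- right; exists (c + dotz u p), (monomial val 1 u); split.
    by apply: (fcn_neq0 (q := 0)); rewrite monomialE.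
  (* For a monomial the two sides are equal everywhere, not just near [p]. *)
  apply: eq_ind (cong_refl _ _) _ _; apply/(fcn_evalP (iota := idfun)) => q.
  rewrite fcn_evalM translateE cstE !monomialE rmorph1 mul1r dotzB.
  by move: (dotz u q) (dotz u p) => x y; congr Some; lra.
- by left; apply/(fcn_evalP (iota := idfun)) => q; rewrite monomialE fcn_eval0.
case=> [->|[a [phi [phi0 ga]]]]; case=> [->|[b [psi [psi0 gb]]]];
  rewrite ?addr0 ?add0r.
- by left.
- by right; exists b, psi.
- by right; exists a, phi.
right; have gab := cong_add ga gb.
case: (ltgtP a b) => ab.
- exists b, psi; split=> //; apply: cong_trans gab _.
  rewrite addrC; apply: germ_absorb ab; exact: cst_translate_eval.
- exists a, phi; split=> //; apply: cong_trans gab _.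
  apply: germ_absorb ab; exact: cst_translate_eval.
- exists a, (phi + psi); split; last by rewrite translateD mulrDr {2}ab.
  apply: (fcn_neq0 (q := 0)).
  by rewrite fcn_evalD (boolfcn_eval0 phi0) (boolfcn_eval0 psi0).
Qed.

End Translation.

(** * Congruences that fail to separate values at [p] *)

Section Collapse.
Variables (R : realType) (n : nat) (p : 'rV[R]_n).
Variable C : congruence (tropfcn R n).
Hypothesis germC : forall f g, germ_cong p f g -> C f g.

(** For [c] strictly between the values at [p], [C] relates [f], [f + cst n c], [g + cst n c] and
    [cst n c] in turn; the outer two links are germ equalities. *)
Lemma cong_cst_interval f g a : C f g -> fcn_eval f p = Some a ->
  g = 0 \/ (exists2 b, fcn_eval g p = Some b & b < a) ->
  exists2 b, b < a & forall c, b < c < a -> C f (cst n c).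
Proof.
move=> Cfg fa hg.
have [b ba gb] : exists2 b, b < a & forall c, b < c -> C (g + cst n c) (cst n c).
  case: hg => [->|[b gb ba]].
    (* If [g = 0], any number below [a] can serve as [b]. *)
    by exists (a - 1); [lra | move=> c _; rewrite add0r; apply: cong_refl].
  exists b => // c bc; apply: germC; rewrite addrC.
  exact: germ_absorb (cstE _ _) gb bc.
exists b => // c /andP[bc ca].
apply: cong_trans (gb _ bc).
apply: cong_trans (cong_add Cfg (cong_refl C (cst n c))).
by apply/cong_sym/germC; apply: germ_absorb fa (cstE _ _) ca.
Qed.

Lemma cong_cst_collapse f a b : b < a ->
  (forall c, b < c < a -> C f (cst n c)) ->
  forall h, h != 0 -> C h 1.
Proof.
move=> ba Cf h; have [->|[h' [_ hh]] _] := fcn_finite h; first by rewrite eqxx.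
pose e := (a - b) / 4.
have e0 : 0 < e by rewrite /e; lra.
have Ce : C (cst n e) 1.
  (* Both [m] and [m + e] lie in the interval from [b] to [a], so their constants are related;
     multiplying by [cst n (- m)] leaves [e] and 0. *)
  pose m := (a + b) / 2.
  have Cm : C (cst n (m + e)) (cst n m).
    by apply: cong_trans (cong_sym (Cf _ _)) (Cf _ _); rewrite /e /m; lra.
  have := cong_mul (cong_refl C (cst n (- m))) Cm.
  by rewrite -!cstD addNr cst0 addKr.
have Cen k : C (cst n (e *+ k)) 1.
  elim: k => [|k IH]; first by rewrite mulr0n cst0; apply: cong_refl.
  by rewrite mulrS cstD -[X in C _ X]mulr1; apply: cong_mul.
have CeN k : C (cst n (- (e *+ k))) 1.
  have := cong_mul (cong_refl C (cst n (- (e *+ k)))) (Cen k).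
  by rewrite -cstD addNr cst0 mulr1 => /cong_sym.
(* By the Archimedean property, constants related to 1 are found on both sides of [h' p]. Then [h]
   absorbs the lower one, the upper one replaces it, and the upper one absorbs [h]. *)
pose k := Num.bound (`|h' p| / e).
have hk : `|h' p| < e *+ k.
  rewrite -mulr_natl -ltr_pdivrMr //; apply: archi_boundP.
  by apply: divr_ge0 => //; apply: ltW.
have [hl hr] : - (e *+ k) < h' p /\ h' p < e *+ k.
  by move: hk; rewrite ltr_norml => /andP.
apply: cong_trans (Cen k).
apply: (cong_trans (y := h + cst n (- (e *+ k)))).
  by apply/cong_sym/germC; apply: germ_absorb (hh p) (cstE _ _) hl.
apply: (cong_trans (y := h + cst n (e *+ k))); last first.
  by rewrite addrC; apply: germC; apply: germ_absorb (cstE _ _) (hh p) hr.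
apply: cong_add (cong_refl _ _) _.
exact: cong_trans (CeN k) (cong_sym (Cen k)).
Qed.

Lemma cong_collapse f g : C f g -> fcn_eval f p <> fcn_eval g p ->
  forall h, h != 0 -> C h 1.
Proof.
(* By symmetry [f] has the larger value at [p]; the case [g = 0] stands for the value -oo. *)
wlog [a fa hg] : f g / exists2 a, fcn_eval f p = Some a &
    g = 0 \/ (exists2 b, fcn_eval g p = Some b & b < a).
  move=> W Cfg ne; have Cgf := cong_sym Cfg; have ne' := nesym ne.
  have [f0|[f' [_ ff]]] := fcn_finite f; have [g0|[g' [_ gg]]] := fcn_finite g.
  - by case: ne; rewrite f0 g0.
  - by apply: (W g f) => //; exists (g' p) => //; left.
  - by apply: (W f g) => //; exists (f' p) => //; left.
  - case: (ltgtP (f' p) (g' p)) => fg.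
    + by apply: (W g f) => //; exists (g' p) => //; right; exists (f' p).
    + by apply: (W f g) => //; exists (f' p) => //; right; exists (g' p).
    + by case: ne; rewrite ff gg fg.
move=> Cfg _; have [b ba Cf] := cong_cst_interval Cfg fa hg.
exact: cong_cst_collapse ba Cf.
Qed.

End Collapse.

(** The isomorphism below is built from the extension to the quotient, opposite to the direction
    required. *)
Lemma semiring_iso_sym (S S' : pzSemiRingType) :
  semiring_iso S S' -> semiring_iso S' S.
Proof.
case=> phi [psi phiK psiK].
have psiD : nmod_morphism psi.
  by split=> [|x y]; apply: (can_inj phiK); rewrite ?rmorph0 ?rmorphD !psiK.
have psiM : monoid_morphism psi.
  by split=> [|x y]; apply: (can_inj phiK); rewrite ?rmorph1 ?rmorphM !psiK.
pose m1 := GRing.isNmodMorphism.Build S' S psi psiD.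
pose m2 := GRing.isMonoidMorphism.Build S' S psi psiM.
pose Psi : {rmorphism S' -> S} := HB.pack psi m1 m2.
by exists Psi; exists phi.
Qed.

(** * The isomorphism with the extension when [C] separates values at [p] *)

Section Extension.
Variables (R : realType) (n : nat) (p : 'rV[R]_n).
Variable C : congruence (tropfcn R n).
Hypothesis germC : forall f g, germ_cong p f g -> C f g.
Hypothesis evalC : forall f g, C f g -> fcn_eval f p = fcn_eval g p.
Local Notation B := (boolfcn R n).

Definition initial_cong : congruence B.
Proof.
refine (@Congruence _ (fun f g : B => C (translate p f) (translate p g)) _ _ _ _ _).
- by move=> f; apply: cong_refl.
- by move=> f g; apply: cong_sym.
- by move=> f g h; apply: cong_trans.
- by move=> f f' g g' ff gg; rewrite !translateD; apply: cong_add.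
- by move=> f f' g g' ff gg; rewrite !translateM; apply: cong_mul.
Defined.

Local Notation pi := (squot_pi initial_cong).

(** A nonzero Boolean function has translate of value 0 at [p], which [evalC] keeps apart from
    -oo. *)
Lemma initial_pi_eq0 (f : B) : (pi f == 0) = (f == 0).
Proof.
apply/eqP/eqP => [/(squot_piP initial_cong f 0) /evalC|->]; last exact: rmorph0.
case: (eqVneq f 0) => // /(translate_eval p) ->.
by rewrite translate0 fcn_eval0.
Qed.

Lemma initial_extendable : extendable (squot initial_cong).
Proof.
split.
- exists 1; rewrite -(rmorph1 pi) initial_pi_eq0.
  by apply: (fcn_neq0 (q := 0)); rewrite fcn_eval1.
- elim/squot_ind=> f; elim/squot_ind=> g.
  rewrite -rmorphD !initial_pi_eq0 => f0 g0.
  apply: (fcn_neq0 (q := 0)).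
  by rewrite fcn_evalD (boolfcn_eval0 f0) (boolfcn_eval0 g0).
- elim/squot_ind=> f; elim/squot_ind=> g.
  rewrite -rmorphM !initial_pi_eq0 => f0 g0.
  apply: (fcn_neq0 (q := 0)).
  by rewrite fcn_evalM (boolfcn_eval0 f0) (boolfcn_eval0 g0).
Qed.

Local Notation X := (textension initial_extendable R).
Local Notation Q := (squot C).

Definition unextend (x : X) : Q :=
  if x is Some (f, a) then squot_pi C (cst n a * translate p (repr (val f)))
  else 0.

(** Independence of the chosen representative, which is exactly how [initial_cong] is defined. *)
Lemma unextend_valE s (f : B) a : val s = pi f ->
  unextend (Some (s, a)) = squot_pi C (cst n a * translate p f).
Proof.
move=> sf; apply/squot_piP; apply: cong_mul (cong_refl _ _) _.
by rewrite sf; exact: (squot_reprP initial_cong f).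
Qed.

Lemma unextendE (f : B) (f0 : pi f != 0) a :
  unextend (Some (exist _ (pi f) f0, a)) = squot_pi C (cst n a * translate p f).
Proof. exact: unextend_valE. Qed.

Lemma textension_ind (P : X -> Prop) : P None ->
  (forall (f : B) (f0 : pi f != 0) a, P (Some (exist _ (pi f) f0, a))) ->
  forall x, P x.
Proof. by move=> P0 PS [[[f]]|//]; elim/squot_ind: f. Qed.

(** The value at [p] recovers [a]; multiplying by [cst n (- a)] then recovers the class of the
    Boolean part. *)
Lemma unextend_inj : injective unextend.
Proof.
elim/textension_ind=> [|f f0 a]; elim/textension_ind=> [|g g0 b] //.
- rewrite unextendE => /(squot_piP C 0) /evalC.
  by rewrite cst_translate_eval -?initial_pi_eq0 // fcn_eval0.
- rewrite unextendE => /(squot_piP C _ 0) /evalC.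
  by rewrite cst_translate_eval -?initial_pi_eq0 // fcn_eval0.
rewrite !unextendE => /squot_piP Cfg; have := evalC Cfg.
rewrite !cst_translate_eval -?initial_pi_eq0 // => -[ab]; subst b.
congr (Some (_, _)); apply: val_inj => /=; apply/squot_piP => /=.
have := cong_mul (cong_refl C (cst n (- a))) Cfg.
by rewrite !mulrA -!cstD addNr cst0 !mul1r.
Qed.

Lemma unextend_surj (y : Q) : exists x, unextend x = y.
Proof.
elim/squot_ind: y => f; have [->|[a [phi [phi0 fphi]]]] := germ_decomp p f.
  by exists None; rewrite rmorph0.
rewrite -initial_pi_eq0 in phi0.
exists (Some (exist _ (pi phi) phi0, a)); rewrite unextendE.
exact/squot_piP/cong_sym/germC.
Qed.

Lemma unextend_bij : bijective unextend.
Proof.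
pose inv y := sval (cid (unextend_surj y)).
have invK y : unextend (inv y) = y by rewrite /inv; case: cid.
by exists inv => // x; apply: unextend_inj; rewrite invK.
Qed.

(** The three cases of addition in the extension mirror sums of germs: absorption when [a] and [b]
    differ, distributivity when they agree. *)
Lemma unextend_nmod_morphism : nmod_morphism unextend.
Proof.
split=> //; elim/textension_ind=> [|f f0 a]; elim/textension_ind=> [|g g0 b].
- by rewrite [LHS]/= addr0.
- by rewrite [unextend None]/= !add0r.
- by rewrite [unextend None]/= !addr0.
have [f1 g1] : f != 0 /\ g != 0 by rewrite -!initial_pi_eq0.
rewrite !unextendE -rmorphD {1}/GRing.add /=; case: ltgtP => ab.
- rewrite unextendE; apply/squot_piP/cong_sym/germC.
  exact: germ_absorb (cst_translate_eval p a f1) (cst_translate_eval p b g1) ab.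
- rewrite unextendE; apply/squot_piP/cong_sym/germC; rewrite addrC.
  exact: germ_absorb (cst_translate_eval p b g1) (cst_translate_eval p a f1) ab.
- rewrite ab -mulrDr -translateD; apply: unextend_valE.
  exact: (esym (rmorphD pi f g)).
Qed.

Lemma unextend_monoid_morphism : monoid_morphism unextend.
Proof.
split.
  by rewrite (@unextend_valE _ 1 0) ?rmorph1 ?cst0 ?translate1 ?mulr1.
elim/textension_ind=> [|f f0 a]; elim/textension_ind=> [|g g0 b].
- by rewrite [LHS]/= mulr0.
- by rewrite [unextend None]/= !mul0r.
- by rewrite [unextend None]/= !mulr0.
rewrite ![in RHS]unextendE -rmorphM.
transitivity (squot_pi C (cst n (a + b) * translate p (f * g))).
  by apply: unextend_valE; exact: (esym (rmorphM pi f g)).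
by rewrite cstD translateM -!mulrA (mulrA (cst n b)) (cst_comm b) -mulrA.
Qed.

Lemma unextend_iso : semiring_iso X Q.
Proof.
pose m1 := GRing.isNmodMorphism.Build X Q unextend unextend_nmod_morphism.
pose m2 := GRing.isMonoidMorphism.Build X Q unextend unextend_monoid_morphism.
pose phi : {rmorphism X -> Q} := HB.pack unextend m1 m2.
by exists phi; exact: unextend_bij.
Qed.

End Extension.

Theorem theorem1p1 (R : realType) (n : nat) (hn : (1 <= n)%N) (p : 'rV[R]_n) :
  (forall C : congruence (tropfcn R n),
     (forall f g, germ_cong p f g -> C f g) ->
     let a := forall f g, C f g -> fcn_eval f p = fcn_eval g p in
     let b := forall f g : tropfcn R n, f <> 0 -> g <> 0 -> C f g in
     (a /\ ~ b) \/ (~ a /\ b)) /\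
  (forall C : congruence (tropfcn R n),
     (forall f g, germ_cong p f g -> C f g) ->
     (forall f g, C f g -> fcn_eval f p = fcn_eval g p) ->
     exists (C' : congruence (boolfcn R n)) (h : extendable (squot C')),
       semiring_iso (squot C) (textension h R)).
Proof.
split=> C germC; last first.
  move=> evalC; exists (initial_cong p C), (initial_extendable evalC).
  by apply: semiring_iso_sym; apply: unextend_iso.
move=> a b; case: (pselect a) => [ha|na]; [left | right]; split=> //.
  (* The constants 1 and 0 are nonzero with different values at [p], so both conditions cannot
     hold. *)
  move=> hb; have /ha : C (cst n 1) (cst n 0) by apply: hb; apply/eqP/cst_neq0.
  by rewrite !cstE => -[] /eqP; rewrite oner_eq0.
move=> f g /eqP f0 /eqP g0.
have [f1 [g1 [Cfg ne]]] : exists f g, C f g /\ fcn_eval f p <> fcn_eval g p.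
  apply: contrapT => H; apply: na => f1 g1 Cfg; apply: contrapT => ne.
  by apply: H; exists f1, g1.
have H := cong_collapse germC Cfg ne.
exact: cong_trans (H _ f0) (cong_sym (H _ g0)).
Qed.
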